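(* Let $\mathbb{X}$ be a metrizable topological space whose Borel $\sigma$-algebra is countably generated, let $\mu$ be a $\sigma$-finite Radon measure on $\mathbb{X}$, let $\mathbb{Y}=\mathbb{X}$ and let $h\colon\mathbb{X}\to\mathbb{Y}$ be the identity map. Then, for $h_\star\mu$-almost every $y\in\mathbb{Y}$, $$\mu^h(\,\cdot\mid y)=\delta_y,$$ the Dirac measure at $y$.
   Context: Disintegration: given a measurable map $h\colon\mathbb{X}\to\mathbb{Y}$ and a measure $\mu$ on $\mathbb{X}$, a disintegration of $\mu$ with respect to $h$ is a map $(A,y)\mapsto\mu^h(A\mid y)\in[0,\infty]$ such that $\mu^h(\,\cdot\mid y)$ is a measure on $\mathbb{X}$ for all $y\in\mathbb{Y}$, $y\mapsto\mu^h(A\mid y)$ is measurable for every measurable $A\subset\mathbb{X}$, (i) $\mu^h(\mathbb{X}\setminus h^{-1}(\{y\})\mid y)=0$, and (ii) $\mu(A)=\int_{\mathbb{Y}}\mu^h(A\mid y)\,h_\star\mu(dy)$ for every measurable $A$, where $h_\star\mu$ is the pushforward. Under the assumptions here it exists and is unique up to $h_\star\mu$-null sets of $y$. *)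

(* Defs.v *)
From HB Require Import structures.
From mathcomp Require Import all_boot all_order all_algebra.
From mathcomp Require Import all_classical all_reals all_analysis.

Set Implicit Arguments.
Unset Strict Implicit.
Unset Printing Implicit Defensive.

Import Order.TTheory GRing.Theory Num.Theory.

Local Open Scope classical_set_scope.
Local Open Scope ring_scope.
Local Open Scope ereal_scope.

(* Measurable spaces are pointed in MathComp-Analysis, so [borel_type X] is a
   [measurableType] only for X : ptopologicalType. *)
Notation borel_type X := (g_sigma_algebraType (@open X)).

(* All models of [realType] being isomorphic, the choice of R is immaterial. *)
Definition metrizable (R : realType) (X : topologicalType) : Prop :=
  exists (M : metricType R) (f : X -> M) (g : M -> X),
    [/\ cancel f g, cancel g f, continuous f & continuous g].

Definition countably_generated d (T : measurableType d) : Prop :=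
  exists2 G : set (set T), countable G & d.-measurable = <<s G >>.

(* Intended for Hausdorff X, where compact sets are closed, hence Borel. On a
   metrizable X, finiteness on compact sets can equivalently be replaced by
   local finiteness. *)
Definition radon (R : realType) (X : ptopologicalType)
    (mu : {measure set (borel_type X) -> \bar R}) : Prop :=
  (forall K : set X, compact K -> mu K < +oo) /\
  (forall A : set (borel_type X), measurable A ->
     mu A = ereal_sup [set mu K | K in [set K : set X | compact K /\ K `<=` A]]).

HB.instance Definition _ d (T : measurableType d) :=
  isMeasurableFun.Build d d T T idfun (@measurable_id _ _ setT).

(* The requirements that each k y be a measure and that y |-> k y A be
   measurable are those of a kernel. *)
Definition disintegration d d' (R : realType)
    (X : measurableType d) (Y : measurableType d') (h : {mfun X >-> Y})
    (mu : {measure set X -> \bar R}) (k : R.-ker Y ~> X) : Prop :=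
  (forall y, k y (~` (h @^-1` [set y])) = 0) /\
  (forall A, measurable A -> mu A = \int[pushforward mu h]_y k y A).

(* Main.v *)
Require Import Defs.
From HB Require Import structures.
From mathcomp Require Import all_boot all_order all_algebra.
From mathcomp Require Import all_classical all_reals all_analysis.
From mathcomp Require Import measurable_realfun.

Set Implicit Arguments.
Unset Strict Implicit.
Unset Printing Implicit Defensive.

Import Order.TTheory GRing.Theory Num.Theory.

Local Open Scope classical_set_scope.
Local Open Scope ring_scope.
Local Open Scope ereal_scope.

(* Each muh(. | y) is concentrated on {y}, so it equals c(y) delta_y with
   c(y) = muh(X | y). Disintegrating mu then says that mu(A) is the integral of
   c over A for every Borel set A, whence c = 1 almost everywhere because mu is
   sigma-finite. *)

(** As [f] is injective, a point is the preimage of its image, which is closed because metric spaces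
    are Hausdorff. *)
Lemma metrizable_closed_set1 (R : realType) (X : topologicalType) :
  metrizable R X -> forall x : X, closed [set x].
Proof.
move=> [M [f [g [fK _ cf _]]]] x.
rewrite [X in closed X](_ : _ = f @^-1` [set f x]); last first.
  by apply/seteqP; split => [z ->//|z] /(can_inj fK).
apply: (iffLR (continuous_closedP f) cf).
exact/accessible_closed_set1/hausdorff_accessible/metric_hausdorff.
Qed.

(** A measurable set missing [y] is null, so one containing [y] has null complement and carries the
    full mass. *)
Lemma measure_concentrated_dirac d (T : measurableType d) (R : realType)
    (nu : {measure set T -> \bar R}) (y : T) :
  measurable [set y] -> nu (~` [set y]) = 0 ->
  forall A, measurable A -> nu A = nu setT * \d_y A.
Proof.
move=> my nu0.
have null B : measurable B -> ~ B y -> nu B = 0.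
  move=> mB By; apply/eqP; rewrite -measure_le0 -nu0 le_measure ?inE//.
    exact: measurableC.
  by move=> z /[swap] /= -> /By.
move=> A mA; rewrite diracE; have [yA|yA] := boolP (y \in A).
  rewrite mule1 -(setUv A) measureU0//; first exact: measurableC.
  by apply: null; [exact: measurableC|exact: (fun nAy => nAy (set_mem yA))].
(* Here [nu setT] may be [+oo]; the convention [+oo * 0 = 0] applies. *)
by rewrite mule0; apply: null => // /mem_set; rewrite (negbTE yA).
Qed.

(** Uniqueness of integrable densities, applied to [c] and 1 on each of countably many pieces of
    finite measure. *)
Lemma density_self_ae1 d (T : measurableType d) (R : realType)
    (mu : {sigma_finite_measure set T -> \bar R}) (c : T -> \bar R) :
  measurable_fun setT c -> (forall x, 0 <= c x) ->
  (forall A, measurable A -> mu A = \int[mu]_(x in A) c x) ->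
  {ae mu, forall x, c x = 1}.
Proof.
move=> mc c0 muE; have [F FT mF] := sigma_finiteT mu.
suff : forall n, {ae mu, forall x, F n x -> c x = 1}.
  move=> /ae_foralln; apply: filterS => x cx.
  by have : [set: T] x by []; rewrite FT => -[n _ /cx].
move=> n; have [mFn Fnoo] := mF n.
apply: (@integral_ae_eq _ _ _ mu _ mFn (cst 1) c) => //.
- apply/integrableP; split; first exact: measurable_funS mc.
  (* The integral of [c] over [F n] is [mu (F n)], which is finite. *)
  by under eq_integral do rewrite gee0_abs//; rewrite -muE.
- by move=> E EF mE; rewrite -muE// integral_cst// mul1e.
Qed.

Theorem lemma2p6 (R : realType) (X : ptopologicalType)
    (hX : metrizable R X)
    (hB : countably_generated (borel_type X))
    (mu : {sigma_finite_measure set (borel_type X) -> \bar R})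
    (hmu : radon mu)
    (muh : R.-ker borel_type X ~> borel_type X)
    (hmuh : disintegration idfun mu muh) :
  {ae pushforward mu idfun, forall y : borel_type X,
     forall A, measurable A -> muh y A = \d_y A}.
Proof.
have [muh0 muE] := hmuh.
have muhE (y : borel_type X) A : measurable A ->
    muh y A = muh y setT * \d_y A.
  apply: measure_concentrated_dirac; last exact: muh0.
  rewrite -(setCK [set y]); apply: measurableC; apply: sub_sigma_algebra.
  exact/closed_openC/(metrizable_closed_set1 hX).
have : {ae mu, forall y, muh y setT = 1}.
  apply: density_self_ae1 => // [|A mA]; first exact: measurable_kernel.
  (* The pushforward along the identity is [mu] by conversion, and the factor [\d_y A] cuts the
     integral down to [A]. *)
  rewrite muE// [RHS]integral_mkcond; apply: (@eq_integral _ _ _ mu) => y _.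
  by rewrite muhE// diracE patchE; case: ifPn; rewrite ?mule1 ?mule0.
(* The exceptional null set depends only on the total mass, so one set serves all [A]. *)
by apply: filterS => y y1 A mA; rewrite muhE// y1 mul1e.
Qed.
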